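(* Let $\sigma>0$, $\bar\gamma>0$, $c_\infty\ge0$, and for $\gamma\in(0,\bar\gamma]$ let $\tau_\gamma:[0,\infty)\to[0,\infty)$ be non-decreasing with $\tau_\gamma(0)=0$, such that there exist $R_1,L\ge0$, $m>0$ with $\sup_{r>0}\tau_\gamma(r)/r\le1+\gamma L$ and $\sup_{r>R_1}\tau_\gamma(r)/r\le1-\gamma m$ for all $\gamma\in(0,\bar\gamma]$. Let $Q_\gamma$ be the Markov kernel on $[0,\infty)$ $$Q_\gamma(w,A)=\delta_0(A)\int_{\mathbb{R}}\bar p_{\sigma^2\gamma}(\tau_\gamma(w)+\gamma c_\infty,g)\varphi(g)dg+\int_{\mathbb{R}}\mathbb{1}_A(\tau_\gamma(w)+\gamma c_\infty-2\sigma\gamma^{1/2}g)\{1-\bar p_{\sigma^2\gamma}(\tau_\gamma(w)+\gamma c_\infty,g)\}\varphi(g)dg,$$ with $\bar p_{\sigma^2\gamma}(a,g)=1\wedge\varphi_{\sigma^2\gamma}(a-\sigma\sqrt\gamma g)/\varphi_{\sigma^2\gamma}(\sigma\sqrt\gamma g)$, and let $\mu_\gamma$ be its unique invariant probability measure. Let $\zeta=2(1+\bar\gamma L)^2\sigma^2(2\sqrt{2\pi})^{-1}[\sup_{t\ge0}\{t^2\Phi(-t)\}+1/8]$ and $R\ge0$. Then for any $\gamma\in(0,\bar\gamma]$ and $\bar\delta\in(0,\{L^{-1}\wedge(\sigma e^{-1}/c_\infty)^2\}]$ (convention $1/0=+\infty$), $\mu_\gamma((0,R))\le\eta_Rc_\infty$,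 where $$\eta_R=[\bar\delta+\bar\gamma]^{1/2}\Big[\frac{2\zeta e^{3(\bar\delta+\bar\gamma)L}}{\sigma^3}+\frac{e^{(\bar\delta+\bar\gamma)L}}{2\sqrt{2\pi}\sigma}\Big]\Big/\Phi\Big(-\frac{(1+\bar\gamma L)R+(\bar\delta+\bar\gamma)c_\infty}{2\bar\delta^{1/2}\sigma e^{-(\bar\delta+\bar\gamma)L}}\Big).$$
   Context: $\varphi$ and $\Phi$ are the standard normal density and distribution function; $\varphi_s(t)=(2\pi s)^{-1/2}e^{-t^2/(2s)}$. *)

(* Defs.v *)
From HB Require Import structures.
From mathcomp Require Import all_boot all_order all_algebra.
From mathcomp Require Import all_classical all_reals all_analysis.
Set Implicit Arguments. Unset Strict Implicit. Unset Printing Implicit Defensive.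
Import Order.TTheory GRing.Theory Num.Theory.
Import numFieldNormedType.Exports.
Local Open Scope classical_set_scope.
Local Open Scope ring_scope.

Section Defs.
Variable R : realType.

Definition phis (s t : R) : R :=
  (Num.sqrt (2 * pi * s))^-1 * expR (- (t ^+ 2) / (2 * s)).

Definition phi (t : R) : R := phis 1 t.

Definition Phi (x : R) : R :=
  Rintegral lebesgue_measure `]-oo, x] phi.

Definition pbar (sigma gamma a g : R) : R :=
  Num.min 1 (phis (sigma ^+ 2 * gamma) (a - sigma * Num.sqrt gamma * g)
             / phis (sigma ^+ 2 * gamma) (sigma * Num.sqrt gamma * g)).

Definition Qker (sigma cinf gamma : R) (tau : R -> R) (w : R) (A : set R)
  : \bar R :=
  let a := tau w + gamma * cinf in
  ((\1_A 0)%:E *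
     \int[lebesgue_measure]_(g in setT) (pbar sigma gamma a g * phi g)%:E
   + \int[lebesgue_measure]_(g in setT)
       (\1_A (a - 2 * sigma * Num.sqrt gamma * g)
        * (1 - pbar sigma gamma a g) * phi g)%:E)%E.

Definition zeta (sigma gbar L : R) : R :=
  2 * (1 + gbar * L) ^+ 2 * sigma ^+ 2 * (2 * Num.sqrt (2 * pi))^-1
  * (sup [set t ^+ 2 * Phi (- t) | t in [set t : R | 0 <= t]] + 8^-1).

Definition etaR (sigma gbar L cinf dbar Rr : R) : R :=
  Num.sqrt (dbar + gbar)
  * (2 * zeta sigma gbar L * expR (3 * (dbar + gbar) * L) / sigma ^+ 3
     + expR ((dbar + gbar) * L) / (2 * Num.sqrt (2 * pi) * sigma))
  / Phi (- (((1 + gbar * L) * Rr + (dbar + gbar) * cinf)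
            / (2 * Num.sqrt dbar * sigma * expR (- ((dbar + gbar) * L))))).

End Defs.

(* Main.v *)
Require Import Defs.
From HB Require Import structures.
From mathcomp Require Import all_boot all_order all_algebra.
From mathcomp Require Import all_classical all_reals all_analysis.
From mathcomp Require Import measurable_realfun ring lra.
Import Order.TTheory GRing.Theory Num.Theory.
Import numFieldNormedType.Exports.
Local Open Scope classical_set_scope.
Local Open Scope ring_scope.

(* Let f_v(w) = P(|N(0,v)| < w), which is [ball_mass v w 0] and equals
   2 Phi(w / sqrt v) - 1 for w > 0. The kernel moves w to
   tau w + gamma c plus a Gaussian of variance u = 4 sigma^2 gamma, stuck at 0 by
   reflection coupling, so that by the reflection principle
   Q f_v(w) = f_{v+u}(tau w + gamma c), where f_0 is the indicator of (0,oo).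
   As tau w <= k w with k = 1 + gamma L, this is at most
   f_{(v+u)/k^2}(w) + 2 gamma c phi_{v+u}(0). Integrating against mu and iterating
   n ~ dbar / gamma times from v = 0, one gets
     mu(0,oo) <= int f_{v_n} dmu + 2 gamma c sum_j phi_{v_j+u}(0),
   where the error is of order c sqrt(n gamma), and 1 - f_{v_n} is at least
   2 Phi(-R / sqrt v_n) on (0,R). Invariance on rays suffices for this: by Tonelli,
   int f_v dmu = int phi_v(y) mu(]|y|,oo[) dy. *)

(** * Affine substitution in Lebesgue integrals *)

Lemma lebesgue_measure_affine (R : realType) (a b : R) (A : set R) :
  b != 0 -> measurable A ->
  lebesgue_measure A =
  (`|b|%:E * lebesgue_measure [set x : R | A (a + b * x)%R])%E.
Proof.
move=> b0 mA.
pose f : measurableTypeR R -> measurableTypeR R := fun x => a + b * x.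
have mf : measurable_fun setT f.
  by apply: measurable_funD => //; exact: measurable_funM.
have k0 : 0 <= `|b| by [].
pose nu := mscale (NngNum k0) (pushforward lebesgue_measure f).
rewrite -[RHS]/(nu mf A).
(* Uniqueness leaves only half-open intervals to check. For [b < 0] the preimage is closed at the
   other end, which does not change its length. *)
apply: lebesgue_measure_unique => //= _ [[x y]] _ <-.
rewrite /nu /mscale/= /pushforward.
have [b1|b1|b1] := ltgtP b 0; last by rewrite b1 eqxx in b0.
- have -> : f @^-1` `]x, y] = `[(y - a) / b, (x - a) / b[%classic.
    apply/seteqP; split => z /=; rewrite !in_itv/= /f;
    by rewrite ler_ndivrMr// ltr_ndivlMr// => /andP[? ?]; apply/andP; split; lra.
  rewrite !lebesgue_measure_itv/= !lte_fin ltr_ndivrMr// divfK// ltrD2r.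
  case: ifPn => _; last by rewrite mule0.
  rewrite -EFinB -EFinB -EFinM ltr0_norm//; congr EFin; field.
  by rewrite lt_eqF.
- have -> : f @^-1` `]x, y] = `](x - a) / b, (y - a) / b]%classic.
    apply/seteqP; split => z /=; rewrite !in_itv/= /f;
    by rewrite ler_pdivlMr// ltr_pdivrMr// => /andP[? ?]; apply/andP; split; lra.
  rewrite !lebesgue_measure_itv/= !lte_fin ltr_pdivrMr// divfK// ltrD2r.
  case: ifPn => _; last by rewrite mule0.
  rewrite -EFinB -EFinB -EFinM gtr0_norm//; congr EFin; field.
  by rewrite gt_eqF.
Qed.

Lemma ge0_integral_affine (R : realType) (a b : R) (f : R -> \bar R) :
  b != 0 -> measurable_fun [set: R] f -> (forall x, 0 <= f x)%E ->
  (\int[lebesgue_measure]_x f x =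
   `|b|%:E * \int[lebesgue_measure]_x f (a + b * x)%R)%E.
Proof.
move=> b0 mf f0.
pose g : measurableTypeR R -> measurableTypeR R := fun x => a + b * x.
have mg : measurable_fun setT g.
  by apply: measurable_funD => //; exact: measurable_funM.
have k0 : 0 <= `|b| by [].
pose nu := mscale (NngNum k0) (pushforward lebesgue_measure g).
rewrite (@eq_measure_integral _ _ _ _ (nu mg)); last first.
  by move=> A mA _; exact: lebesgue_measure_affine.
rewrite ge0_integral_mscale//; congr (_ * _)%E.
by rewrite ge0_integral_pushforward.
Qed.

(* [tau] is arbitrary on negative reals, so that the kernel need not be measurable
   in its starting point and [ge0_le_integral] does not apply to it. *)
Lemma ge0_le_integral_nonmeasurable d (T : measurableType d) (R : realType)
    (mu : {measure set T -> \bar R}) (f g : T -> \bar R) :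
  (forall x, 0 <= f x)%E -> (forall x, f x <= g x)%E ->
  (\int[mu]_x f x <= \int[mu]_x g x)%E.
Proof.
move=> f0 fg; rewrite !ge0_integralTE//; last by move=> x; exact: le_trans (fg x).
apply: le_ereal_sup => _ [h hf <-]; exists h => //= x.
exact: le_trans (hf x) (fg x).
Qed.

(** * Centred Gaussian densities and their convolution *)

Section gaussian.
Context {R : realType}.
Implicit Types u v w x y : R.
Local Notation leb := (@lebesgue_measure R).

Lemma phis_ge0 v x : 0 <= phis v x.
Proof. by rewrite mulr_ge0 ?invr_ge0 ?expR_ge0. Qed.

Lemma phis_gt0 v x : 0 < v -> 0 < phis v x.
Proof.
by move=> v0; rewrite mulr_gt0 ?expR_gt0// invr_gt0 sqrtr_gt0 !mulr_gt0 ?pi_gt0.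
Qed.

Lemma phisN v x : phis v (- x) = phis v x.
Proof. by rewrite /phis sqrrN. Qed.

Lemma le_phis v x y : 0 < v -> `|x| <= `|y| -> phis v y <= phis v x.
Proof.
move=> v0 xy; rewrite /phis ler_wpM2l ?invr_ge0// ler_expR !mulNr lerN2.
rewrite ler_wpM2r ?invr_ge0 ?mulr_ge0 ?(ltW v0)//.
by rewrite -[x ^+ 2]real_normK ?num_real// -[y ^+ 2]real_normK ?num_real// ler_sqr ?nnegrE.
Qed.

Lemma phis_scale b v x : 0 < b -> 0 < v ->
  phis (b ^+ 2 * v) (b * x) = b^-1 * phis v x.
Proof.
move=> b0 v0; rewrite /phis mulrCA sqrtrM ?sqr_ge0// sqrtr_sqr gtr0_norm//.
rewrite invfM [RHS]mulrA; congr (_ * _ * expR _); field.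
by rewrite !gt_eqF.
Qed.

Lemma phisE m v : 0 < v -> (fun x => phis v (x - m)) = normal_pdf m (Num.sqrt v).
Proof.
move=> v0; rewrite normal_pdfE ?sqrtr_eq0 -?ltNge//; apply/funext => x.
rewrite /phis /normal_peak /normal_fun sqr_sqrtr ?(ltW v0)//.
by congr ((Num.sqrt _)^-1 * expR (_ / _)); ring.
Qed.

Lemma measurable_phis v : measurable_fun [set: R] (phis v).
Proof.
apply: measurable_funM => //; apply: measurableT_comp => //.
by apply: measurable_funM => //; exact: measurableT_comp.
Qed.

Lemma integral_phis m v : 0 < v -> (\int[leb]_x (phis v (x - m))%:E = 1)%E.
Proof.
move=> v0; rewrite -[RHS](integral_normal_pdf m (Num.sqrt v)).
by apply: eq_integral => x _; rewrite -phisE.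
Qed.

(** Completing the square in [z]: the exponents add up to a term in [x] alone and a Gaussian in [z]
    with mean [x * u / (u + v)]. Only that last factor depends on [z], and it integrates to 1, which
    gives the convolution formula. *)
Lemma phisM u v x z : 0 < u -> 0 < v ->
  phis u z * phis v (x - z) =
  phis (u + v) x * phis (u * v / (u + v)) (z - x * u / (u + v)).
Proof.
move=> u0 v0; have uv0 : 0 < u + v by rewrite addr_gt0.
have p0 : 0 < 2 * pi :> R by rewrite mulr_gt0 ?pi_gt0.
rewrite /phis mulrACA [RHS]mulrACA -!invfM -!expRD.
rewrite -!sqrtrM ?mulr_ge0 ?(ltW p0) ?(ltW u0) ?(ltW uv0) ?pi_ge0//.
congr ((Num.sqrt _)^-1 * expR _); field; rewrite ?gt_eqF//.
Qed.

Lemma phis_convolution u v x : 0 < u -> 0 < v ->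
  (\int[leb]_z (phis u z * phis v (x - z))%:E = (phis (u + v) x)%:E)%E.
Proof.
move=> u0 v0; under eq_integral do rewrite phisM// EFinM.
rewrite ge0_integralZl//=.
- by rewrite integral_phis ?mule1// divr_gt0 ?mulr_gt0 ?addr_gt0.
- apply/measurable_EFinP; apply: measurableT_comp; first exact: measurable_phis.
  exact: measurable_funB.
- by move=> z _; rewrite lee_fin phis_ge0.
- by rewrite lee_fin phis_ge0.
Qed.

End gaussian.

(** * Gaussian mass of intervals symmetric about 0 *)

Lemma measurable_fun_natb d (T : measurableType d) (R : realType) (b : T -> bool) :
  measurable_fun setT b -> measurable_fun setT (fun x => (b x)%:R : R).
Proof.
move=> mb; have mA : measurable [set x | b x].
  by rewrite -[X in measurable X]setTI; exact: (mb measurableT [set true]).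
rewrite (_ : (fun _ => _) = \1_[set x | b x]); first exact: measurable_indic.
apply/funext => x; rewrite indicE; congr (nat_of_bool _)%:R.
by apply/idP/idP; rewrite inE.
Qed.

Lemma measurable_fun_lt_nat d (T : measurableType d) (R : realType) (f g : T -> R) :
  measurable_fun setT f -> measurable_fun setT g ->
  measurable_fun setT (fun x => (f x < g x)%R%:R : R).
Proof. by move=> mf mg; apply: measurable_fun_natb; exact: measurable_fun_ltr. Qed.

Section ball_mass.
Context {R : realType}.
Implicit Types u v w x y r : R.
Local Notation leb := (@lebesgue_measure R).

(** The Gaussian has mean [r], while the interval is centred at 0. For [x] and [r] nonnegative this
    is, by reflection, the probability that Brownian motion started at [x] and absorbed at 0 lies
    beyond [r] at time [v]. The interval enters as an indicator, so that the integrand is jointly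
    measurable in all variables, as Tonelli requires. *)
Definition ball_mass v x r : \bar R :=
  (\int[leb]_y ((`|y| < x)%R%:R * phis v (y - r))%:E)%E.

Lemma ball_mass_integrand_ge0 v x r y :
  (0 <= ((`|y| < x)%R%:R * phis v (y - r))%:E)%E.
Proof. by rewrite lee_fin mulr_ge0 ?phis_ge0. Qed.

Lemma measurable_EFin_phisB v r :
  measurable_fun [set: R] (fun y => (phis v (y - r))%:E).
Proof.
apply/measurable_EFinP; apply: measurableT_comp; first exact: measurable_phis.
exact: measurable_funB.
Qed.

Lemma measurable_ball_mass_integrand v x r :
  measurable_fun [set: R] (fun y => ((`|y| < x)%R%:R * phis v (y - r))%:E).
Proof.
apply/measurable_EFinP; apply: measurable_funM.
  apply: measurable_fun_lt_nat => //; exact: measurableT_comp.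
by apply: measurableT_comp; [exact: measurable_phis|exact: measurable_funB].
Qed.
Hint Resolve ball_mass_integrand_ge0 : core.
Hint Extern 0 (measurable_fun _ _) =>
  solve [apply: measurable_ball_mass_integrand | apply: measurable_EFin_phisB] : core.

Lemma ball_mass_ge0 v x r : (0 <= ball_mass v x r)%E.
Proof. by apply: integral_ge0. Qed.

Lemma ball_mass_le1 v x r : 0 < v -> (ball_mass v x r <= 1)%E.
Proof.
move=> v0; rewrite -(integral_phis r v v0); apply: ge0_le_integral => //.
by move=> y _; rewrite lee_fin ler_piMl ?phis_ge0// lern1 leq_b1.
Qed.

Lemma le_ball_mass v x y r : x <= y -> (ball_mass v x r <= ball_mass v y r)%E.
Proof.
move=> xy; apply: ge0_le_integral => // z _; rewrite lee_fin ler_wpM2r ?phis_ge0//.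
by rewrite ler_nat; case: ltP => // zx; rewrite (lt_le_trans zx xy).
Qed.

Lemma ball_mass_le0 v x r : x <= 0 -> ball_mass v x r = 0%E.
Proof.
move=> x0; apply: integral0_eq => y _.
by rewrite ltNge (le_trans x0 (normr_ge0 y)) mul0r.
Qed.

Lemma ball_massN v x r : ball_mass v x (- r) = ball_mass v x r.
Proof.
rewrite [RHS](ge0_integral_affine R 0 (-1))// normrN1 mul1e.
apply: eq_integral => y _; rewrite add0r mulN1r normrN -[phis v (- y - r)]phisN.
by rewrite opprD opprK opprK.
Qed.

Lemma ball_mass_scale v k x : 0 < k -> 0 < v ->
  ball_mass v (k * x) 0 = ball_mass (v / k ^+ 2) x 0.
Proof.
move=> k0 v0; rewrite [LHS](ge0_integral_affine R 0 k) ?gt_eqF//.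
rewrite -ge0_integralZl// ?lee_fin//; last first.
- have mg : measurable_fun [set: R] (fun y => 0 + k * y).
    by apply: measurable_funD => //; exact: measurable_funM.
  exact: (measurableT_comp (measurable_ball_mass_integrand v (k * x) 0) mg).
apply: eq_integral => y _; rewrite add0r !subr0 gtr0_norm// -EFinM normrM.
rewrite gtr0_norm// ltr_pM2l// mulrCA; congr (_ * _)%:E.
rewrite -{1}[v](@divfK _ (k ^+ 2)) ?expf_neq0 ?gt_eqF// [_ / _ * _]mulrC.
by rewrite phis_scale ?divr_gt0 ?exprn_gt0// mulrA divff ?mul1r// gt_eqF.
Qed.

Lemma lebesgue_measure_segment x (h : R) : 0 <= h -> leb `[x, x + h] = h%:E.
Proof.
move=> h0; rewrite lebesgue_measure_itv/= lte_fin ltrDl -EFinB addrAC subrr add0r.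
by case: ltP => // hn; congr EFin; apply/le_anti; rewrite h0 hn.
Qed.

(** The larger interval gains at most two segments of length [h], one on each side, on which the
    density is at most [C]. This pays for the drift of the chain, and also gives a numerical bound
    on the mass of ]-1, 1[. *)
Lemma ball_massD v x (h C : R) : 0 <= h -> 0 <= C ->
    (forall y, x <= `|y| -> phis v y <= C) ->
  (ball_mass v (x + h) 0 <= ball_mass v x 0 + (2 * h * C)%:E)%E.
Proof.
move=> h0 C0 phiC.
have mindic A : measurable A ->
    measurable_fun [set: measurableTypeR R] (fun y => (\1_A y : R)%:E).
  by move=> mA; apply/measurable_EFinP.
have -> : (2 * h * C)%:E = (\int[leb]_y
    (C%:E * ((\1_`[x, x + h] y)%:E + (\1_`[- x - h, - x - h + h] y)%:E)))%E.
  rewrite ge0_integralZl//=; last 2 first.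
  - by apply: emeasurable_funD; exact: mindic.
  - by move=> y _; rewrite adde_ge0// lee_fin.
  rewrite ge0_integralD//; [|exact: mindic|exact: mindic].
  rewrite !integral_indic// !setIT/= !lebesgue_measure_segment// -EFinD -EFinM.
  by congr EFin; ring.
rewrite -ge0_integralD//; last 2 first.
- by move=> y _; rewrite mule_ge0 ?lee_fin// adde_ge0// lee_fin.
- apply: measurable_funeM; apply: emeasurable_funD; exact: mindic.
apply: ge0_le_integral => //.
- apply: emeasurable_funD; first exact: measurable_ball_mass_integrand.
  by apply: measurable_funeM; apply: emeasurable_funD; exact: mindic.
- move=> y _; rewrite -EFinD lee_fin subr0 !indicE.
  have p0 := phis_ge0 v y.
  have [yx|xy] := ltP `|y| x.
    by rewrite (lt_le_trans yx) ?lerDl// mulr_ge0// addr_ge0.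
  rewrite mulr0n mul0r add0r; have [yxh|_] := ltP `|y| (x + h); last first.
    by rewrite mulr0n mul0r mulr_ge0// addr_ge0.
  rewrite mulr1n mul1r (le_trans (phiC _ xy))// ler_peMr//.
  have : (y \in `[x, x + h]%classic) || (y \in `[- x - h, - x - h + h]%classic).
    move: xy yxh; rewrite !mem_setE !in_itv/= => xy yxh.
    case: (ger0P y) xy yxh => y0 xy yxh.
      by rewrite xy ltW.
    by apply/orP; right; apply/andP; split; lra.
  by case/orP => ->; [rewrite lerDl|rewrite lerDr].
Qed.

Lemma measurable_ball_mass_joint u k h :
  measurable_fun setT (fun p : R * R => ball_mass u (k * p.1 + h) p.2).
Proof.
pose f (q : (R * R) * R) :=
  ((`|q.2| < k * q.1.1 + h)%R%:R * phis u (q.2 - q.1.2))%:E.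
have mf : measurable_fun setT f.
  apply/measurable_EFinP; apply: measurable_funM.
    apply: measurable_fun_lt_nat; first exact: measurableT_comp.
    apply: measurable_funD => //; apply: measurable_funM => //.
    exact: measurableT_comp.
  apply: measurableT_comp; first exact: measurable_phis.
  by apply: measurable_funB => //; exact: measurableT_comp.
apply: (measurable_fun_fubini_tonelli_F (m2 := leb) f mf).
by move=> q; rewrite lee_fin mulr_ge0 ?phis_ge0.
Qed.

(** A Gaussian of variance [u] around a centre that is itself Gaussian of variance [v] has variance
    [v + u]. Tonelli moves the integral over the centre inside, where it becomes a convolution. *)
Lemma integral_ball_mass u v x : 0 < u -> 0 < v ->
  (\int[leb]_r ((phis v r)%:E * ball_mass u x r) = ball_mass (v + u) x 0)%E.
Proof.
move=> u0 v0.
pose f (q : R * R) :=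
  ((`|q.2| < x)%R%:R * (phis v q.1 * phis u (q.2 - q.1)))%:E.
have f0 q : (0 <= f q)%E by rewrite lee_fin !mulr_ge0 ?phis_ge0.
have mf : measurable_fun setT f.
  apply/measurable_EFinP; apply: measurable_funM.
    by apply: measurable_fun_lt_nat => //; exact: measurableT_comp.
  apply: measurable_funM; (apply: measurableT_comp; first exact: measurable_phis) => //.
  exact: measurable_funB.
transitivity (\int[leb]_r \int[leb]_y f (r, y))%E.
  apply: eq_integral => r _; rewrite -ge0_integralZl// ?lee_fin ?phis_ge0//.
  by apply: eq_integral => y _; rewrite /f/= -EFinM mulrCA.
transitivity (\int[leb]_y \int[leb]_r f (r, y))%E.
  exact: (fubini_tonelli (m1 := leb) (m2 := leb) f).
apply: eq_integral => y _.
under eq_integral do rewrite /f/= EFinM.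
rewrite ge0_integralZl//=.
- by rewrite phis_convolution// -EFinM subr0.
- apply/measurable_EFinP/measurable_funM; first exact: measurable_phis.
  apply: measurableT_comp; first exact: measurable_phis.
  exact: measurable_funB.
- by move=> r _; rewrite lee_fin mulr_ge0 ?phis_ge0.
Qed.

End ball_mass.

(** * Tails of the kernel, by reflection *)

Section sticky_kernel.
Context {R : realType}.
Implicit Types (sigma gamma cinf a g r w : R) (tau : R -> R).
Local Notation leb := (@lebesgue_measure R).

Lemma pbar_ge0 sigma gamma a g : 0 <= pbar sigma gamma a g.
Proof. by rewrite /pbar le_min ler01 divr_ge0 ?phis_ge0. Qed.

Lemma pbar_le1 sigma gamma a g : pbar sigma gamma a g <= 1.
Proof. by rewrite /pbar ge_min lexx. Qed.

Lemma Qker_ge0 sigma cinf gamma tau w (A : set R) :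
  (0 <= Qker sigma cinf gamma tau w A)%E.
Proof.
apply: adde_ge0; [apply: mule_ge0 => //; apply: integral_ge0|
                  apply: integral_ge0] => g _; rewrite lee_fin.
  by rewrite mulr_ge0 ?pbar_ge0 ?phis_ge0.
by rewrite !mulr_ge0 ?phis_ge0// subr_ge0 pbar_le1.
Qed.

(** The condition puts [g] at or below the midpoint of 0 and [a / s], hence at least as close to 0
    as to [a / s]. The ratio in [pbar] is then at most 1, so the minimum is the ratio, whose
    denominator cancels against [phi g]. *)
Lemma pbarE sigma gamma a g : 0 < sigma -> 0 < gamma ->
  let s := sigma * Num.sqrt gamma in 2 * s * g <= a -> 0 <= a ->
  (1 - pbar sigma gamma a g) * phi g = phi g - phi (g - a / s).
Proof.
move=> sigma0 gamma0 s ga a0.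
have s0 : 0 < s by rewrite mulr_gt0 ?sqrtr_gt0.
have s2 : sigma ^+ 2 * gamma = s ^+ 2 * 1.
  by rewrite mulr1 exprMn sqr_sqrtr ?ltW.
rewrite /pbar -/s s2 (_ : a - s * g = s * (a / s - g)); last first.
  by field; rewrite gt_eqF.
rewrite !phis_scale// -[phis 1 _]/(phi _) -[phis 1 g]/(phi g).
have pg : 0 < phi g by exact: phis_gt0.
rewrite (_ : _ / _ = phi (a / s - g) / phi g); last first.
  by field; rewrite !gt_eqF.
rewrite -[phi (g - _)]phisN opprB -[phis 1 _]/(phi _).
have : phi (a / s - g) <= phi g.
  apply: le_phis => //; have as0 : 0 <= a / s by rewrite divr_ge0// ltW.
  have : 2 * g <= a / s by rewrite ler_pdivlMr// mulrAC.
  by move=> ?; rewrite [leRHS]ger0_norm ?ler_norml; [apply/andP; split|]; lra.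
rewrite -[leRHS]mul1r -ler_pdivrMr// => le1.
by rewrite min_r// mulrBl mul1r divfK// gt_eqF.
Qed.

Lemma integral_phi_ltP (f : R -> R) (b : R) : measurable_fun [set: R] f ->
  (\int[leb]_g ((g <= b)%R%:R * f g)%:E = \int[leb]_g ((g < b)%R%:R * f g)%:E)%E.
Proof.
move=> mf; have mEf : measurable_fun [set: R] (EFin \o f) by exact/measurable_EFinP.
transitivity (\int[leb]_(g in `]-oo, b]) (f g)%:E)%E.
  rewrite [RHS]integral_mkcond; apply: eq_integral => g _.
  rewrite patchE mem_setE in_itv/=; case: ifP => _; by rewrite ?mul1r ?mul0r.
rewrite -(@integral_itv_bndo_bndc _ -oo%O)//; last exact: measurable_funTS.
rewrite [LHS]integral_mkcond; apply: eq_integral => g _.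
rewrite patchE mem_setE in_itv/=; case: ifP => _; by rewrite ?mul1r ?mul0r.
Qed.

(** The atom at 0 misses the ray. Landing beyond [r] means [g < al], where the density of not being
    absorbed is [phi g - phi (g - b)]. Its integral is [Phi al - Phi (al - b)], the normal mass
    between [al - b] and [al], and the substitution [y = r + 2 * s * g] identifies that mass with
    [ball_mass]. *)
Lemma Qker_tail_le sigma cinf gamma tau w r : 0 < sigma -> 0 < gamma -> 0 <= r ->
    0 <= tau w + gamma * cinf ->
  (Qker sigma cinf gamma tau w `]r, +oo[ <=
   ball_mass (4 * sigma ^+ 2 * gamma) (tau w + gamma * cinf) r)%E.
Proof.
move=> sigma0 gamma0 r0; rewrite /Qker; set a := tau w + _ => a0.
rewrite [in X in (X * _)%E]indicE mem_setE in_itv/= ltNge r0/= mul0e add0e.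
pose s := sigma * Num.sqrt gamma.
have s0 : 0 < s by rewrite mulr_gt0 ?sqrtr_gt0.
have s20 : 0 < 2 * s by rewrite mulr_gt0.
have sn20 : 2 * s != 0 by rewrite gt_eqF.
have sn0 : s != 0 by rewrite gt_eqF.
pose al := (a - r) / (2 * s); pose b := a / s.
have mphi : measurable_fun [set: R] (@phi R) by exact: measurable_phis.
have mtail c : measurable_fun [set: R] (fun g => ((g < c)%R%:R * phi g)%:E).
  apply/measurable_EFinP/measurable_funM => //.
  exact: measurable_fun_lt_nat.
have mle c : measurable_fun [set: R] (fun g => ((g <= c)%R%:R * phi g)%:E).
  apply/measurable_EFinP/measurable_funM => //.
  by apply: measurable_fun_natb; exact: measurable_fun_ler.
have mtailb : measurable_fun [set: R]
    (fun g => ((g < al)%R%:R * phi (g - b))%:E).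
  apply/measurable_EFinP/measurable_funM; first exact: measurable_fun_lt_nat.
  by apply: measurableT_comp => //; exact: measurable_funB.
have mmid : measurable_fun [set: R]
    (fun g => ((al - b < g)%R%:R * ((g < al)%R%:R * phi g))%:E).
  apply/measurable_EFinP/measurable_funM; first exact: measurable_fun_lt_nat.
  by apply: measurable_funM => //; exact: measurable_fun_lt_nat.
have ball : ball_mass (4 * sigma ^+ 2 * gamma) a r =
    (\int[leb]_g ((al - b < g)%R%:R * ((g < al)%R%:R * phi g))%:E)%E.
  have s2 : 4 * sigma ^+ 2 * gamma = (2 * s) ^+ 2 * 1.
    by rewrite mulr1 !exprMn sqr_sqrtr ?(ltW gamma0)//; ring.
  rewrite [LHS](ge0_integral_affine R r (2 * s))//; last 2 first.
  - exact: measurable_ball_mass_integrand.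
  - by move=> y; exact: ball_mass_integrand_ge0.
  rewrite -ge0_integralZl ?lee_fin//; last 2 first.
  - have mg : measurable_fun [set: R] (fun y => r + 2 * s * y).
      by apply: measurable_funD => //; exact: measurable_funM.
    exact: (measurableT_comp (measurable_ball_mass_integrand _ a r) mg).
  - by move=> y _; exact: ball_mass_integrand_ge0.
  apply: eq_integral => g _; rewrite -EFinM addrAC subrr add0r s2.
  rewrite phis_scale// gtr0_norm// mulrCA.
  rewrite [2 * s * (_ * _)]mulrA divff// mul1r.
  rewrite (_ : (_ < a) = (al - b < g) && (g < al)); first by rewrite -mulnb natrM -mulrA.
  have -> : al - b = (- a - r) / (2 * s) by rewrite /al /b; field.
  rewrite ltr_norml ltr_pdivrMr// ltr_pdivlMr//.
  by apply/andP/andP => -[]; split; lra.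
have shift : (\int[leb]_g ((g < al)%R%:R * phi (g - b))%:E =
              \int[leb]_g ((g <= al - b)%R%:R * phi g)%:E)%E.
  rewrite integral_phi_ltP// (ge0_integral_affine R b 1)//; last first.
    by move=> g; rewrite lee_fin mulr_ge0 ?phis_ge0.
  rewrite normr1 mul1e; apply: eq_integral => g _.
  by rewrite mul1r addrC addrK -ltrBDr.
have fin : (\int[leb]_g ((g < al)%R%:R * phi (g - b))%:E)%E \is a fin_num.
  rewrite ge0_fin_numE; last first.
    by apply: integral_ge0 => g _; rewrite lee_fin mulr_ge0 ?phis_ge0.
  apply: (@le_lt_trans _ _ 1%E); last exact: ltry.
  rewrite -(integral_phis b 1)//; apply: ge0_le_integral => //.
  - by move=> g _; rewrite lee_fin mulr_ge0 ?phis_ge0.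
  - exact: measurable_EFin_phisB.
  - by move=> g _; rewrite lee_fin ler_piMl ?phis_ge0// lern1 leq_b1.
have QE g : (\1_`]r, +oo[ (a - 2 * sigma * Num.sqrt gamma * g) *
    (1 - pbar sigma gamma a g) * phi g = (g < al)%R%:R * (phi g - phi (g - b))).
  rewrite indicE mem_setE in_itv/= andbT -mulrA -[2 * sigma * _]mulrA -/s.
  rewrite (_ : (r < _) = (g < al)); last first.
    by rewrite /al ltr_pdivlMr//; apply/idP/idP; lra.
  have [gal|_] := ltP g al; last by rewrite !mul0r.
  (* As [0 <= r], the condition [g < al] implies [2 * s * g <= a], the range covered by [pbarE]. *)
  rewrite !mul1r pbarE// -/s.
  by move: gal; rewrite /al ltr_pdivlMr//; lra.
have Q0 g : 0 <= (g < al)%R%:R * (phi g - phi (g - b)).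
  by rewrite -QE !mulr_ge0 ?phis_ge0// subr_ge0 pbar_le1.
under eq_integral do rewrite QE.
(* Instead of subtracting extended reals, the finite integral of the shifted density is added to
   both sides. Pointwise, [g < al] then splits at [al - b]. *)
rewrite -(leeD2rE _ _ fin) -ge0_integralD//; last 3 first.
- by move=> g _; rewrite lee_fin.
- apply/measurable_EFinP/measurable_funM; first exact: measurable_fun_lt_nat.
  apply: measurable_funB => //; apply: measurableT_comp => //.
  exact: measurable_funB.
- by move=> g _; rewrite lee_fin mulr_ge0 ?phis_ge0.
rewrite ball shift -ge0_integralD//; last 3 first.
- by move=> g _; rewrite lee_fin !mulr_ge0 ?phis_ge0.
- by move=> g _; rewrite lee_fin mulr_ge0 ?phis_ge0.
- exact: mle.
apply: ge0_le_integral => //.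
- by move=> g _; rewrite adde_ge0// lee_fin// mulr_ge0 ?phis_ge0.
- apply: emeasurable_funD => //; apply/measurable_EFinP/measurable_funM.
    exact: measurable_fun_lt_nat.
  by apply: measurable_funB => //; apply: measurableT_comp => //; exact: measurable_funB.
- by apply: emeasurable_funD => //; exact: mle.
- move=> g _; rewrite -!EFinD lee_fin -mulrDr subrK.
  have pg := phis_ge0 1 g.
  by case: (ltP (al - b) g) => _; rewrite ?mul1r ?mul0r ?addr0 ?add0r//;
    case: (ltP g al) => _; rewrite ?mul1r ?mul0r.
Qed.

End sticky_kernel.

(** * Invariant measures of a kernel with tails bounded by [ball_mass] *)

Section invariant_measure.
Context {R : realType} (mu : probability R R).
Variables (Q : R -> set R -> \bar R) (u k h : R).
Hypotheses (u0 : 0 < u) (k0 : 0 < k) (h0 : 0 <= h).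
Hypothesis mu_neg : mu `]-oo, 0[%classic = 0%E.
Hypothesis mu_inv : forall A : set R, measurable A ->
  mu A = (\int[mu]_w Q w A)%E.
Hypothesis Q0 : forall w A, (0 <= Q w A)%E.
Hypothesis Q_tail : forall w r : R, 0 <= w -> 0 <= r ->
  (Q w `]r, +oo[%classic <= ball_mass u (k * w + h) r)%E.
Local Notation leb := (@lebesgue_measure R).

Lemma measurable_ball_massl v a b r :
  measurable_fun [set: R] (fun w => ball_mass v (a * w + b) r).
Proof.
have mp : measurable_fun [set: R] (fun w : R => (w, r)) by exact: measurable_pair2.
exact: (measurableT_comp (measurable_ball_mass_joint v a b) mp).
Qed.

Lemma invariant_tail_le r : 0 <= r ->
  (mu `]r, +oo[%classic <= \int[mu]_w ball_mass u (k * w + h) r)%E.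
Proof.
move=> r0; rewrite mu_inv//.
(* Nothing bounds [Q] at negative points. The value +oo there makes the comparison hold everywhere,
   and it costs nothing because that half-line is [mu]-null. *)
pose g w := if (w < 0)%R then +oo%E else ball_mass u (k * w + h) r.
have g0 w : (0 <= g w)%E.
  by rewrite /g; case: ifP => _; [exact: le0y|exact: ball_mass_ge0].
apply: (@le_trans _ _ (\int[mu]_w g w)%E).
  apply: ge0_le_integral_nonmeasurable => // w.
  by rewrite /g; case: ltP => [_|w0]; [exact: leey|exact: Q_tail].
apply: ae_ge0_le_integral => //.
- apply: measurable_fun_ifT => //; last exact: measurable_ball_massl.
  exact: measurable_fun_ltr.
- by move=> w _; exact: ball_mass_ge0.
- exact: measurable_ball_massl.
- exists `]-oo, 0[%classic; split => // w /= /not_implyP[_].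
  by rewrite /g in_itv/=; case: ltP.
Qed.

(** The left side is a Gaussian mixture of masses of rays. Invariance bounds each ray by a
    [ball_mass] of variance [u], and mixing these again adds [v] to the variance. *)
Lemma invariant_ball_mass_le (v : R) : 0 < v ->
  (\int[mu]_w ball_mass v w 0 <= \int[mu]_w ball_mass (v + u) (k * w + h) 0)%E.
Proof.
move=> v0.
pose f (p : R * R) := ((`|p.2| < p.1)%R%:R * phis v (p.2 - 0))%:E.
have mf : measurable_fun setT f.
  apply/measurable_EFinP; apply: measurable_funM.
    by apply: measurable_fun_lt_nat => //; exact: measurableT_comp.
  apply: measurableT_comp; first exact: measurable_phis.
  exact: measurable_funB.
have f0 p : (0 <= f p)%E by exact: ball_mass_integrand_ge0.
have -> : (\int[mu]_w ball_mass v w 0 =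
    \int[leb]_y ((phis v y)%:E * mu `]`|y|%R, +oo[%classic))%E.
  transitivity (\int[leb]_y \int[mu]_w f (w, y))%E.
    exact: (fubini_tonelli (m1 := mu) (m2 := leb) f).
  apply: eq_integral => y _.
  rewrite -[X in (_ * mu X)%E]setIT -integral_indic// -ge0_integralZl//.
  - apply: eq_integral => w _; rewrite -EFinM indicE mem_setE in_itv/= andbT.
    by rewrite /f subr0 mulrC.
  - exact/measurable_EFinP.
  - by rewrite lee_fin phis_ge0.
pose g (p : R * R) := ((phis v p.2)%:E * ball_mass u (k * p.1 + h) p.2)%E.
have g0 p : (0 <= g p)%E by rewrite mule_ge0 ?ball_mass_ge0// lee_fin phis_ge0.
have mg : measurable_fun setT g.
  apply: emeasurable_funM; last exact: measurable_ball_mass_joint.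
  by apply/measurable_EFinP; apply: measurableT_comp; first exact: measurable_phis.
apply: (@le_trans _ _ (\int[leb]_y \int[mu]_w g (w, y))%E).
  apply: ge0_le_integral_nonmeasurable => y.
    by rewrite mule_ge0// lee_fin phis_ge0.
  rewrite /g/= ge0_integralZl//; last 3 first.
  - exact: measurable_ball_massl.
  - by move=> w _; exact: ball_mass_ge0.
  - by rewrite lee_fin phis_ge0.
  rewrite lee_wpmul2l ?lee_fin ?phis_ge0//.
  apply: (le_trans (invariant_tail_le _ (normr_ge0 y))).
  rewrite le_eqVlt; apply/orP; left; apply/eqP.
  apply: eq_integral => w _.
  (* The ray starts at the absolute value of [y], whereas the mixture has centre [y]; [ball_mass] is
     even in its centre. *)
  by have [_|_] := ger0P y; rewrite ?ball_massN.
rewrite -(fubini_tonelli (m1 := mu) (m2 := leb) g)//.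
rewrite le_eqVlt; apply/orP; left; apply/eqP.
apply: eq_integral => w _; rewrite /g/=.
by rewrite -(integral_ball_mass u v (k * w + h) u0 v0).
Qed.

(** The shift [h] costs at most [2 * h] times the peak of the density, and the factor [k] is
    absorbed into the variance. As [mu] has mass 1, the cost survives integration unchanged. *)
Lemma ball_mass_drift_le (v : R) : 0 < v ->
  (\int[mu]_w ball_mass v (k * w + h) 0 <=
   \int[mu]_w ball_mass (v / k ^+ 2) w 0 + (2 * h * phis v 0)%:E)%E.
Proof.
move=> v0.
have mb : measurable_fun [set: R] (fun w => ball_mass (v / k ^+ 2) w 0).
  have := measurable_ball_massl (v / k ^+ 2) 1 0 0.
  by apply: eq_measurable_fun => w _; rewrite mul1r addr0.
have c0 : (0 <= (2 * h * phis v 0)%:E)%E.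
  by rewrite lee_fin mulr_ge0 ?phis_ge0// mulr_ge0.
rewrite -[X in (_ + X)%E]mule1 -(@probability_setT _ _ _ mu) -integral_cst//.
rewrite -ge0_integralD//; last by move=> w _; exact: ball_mass_ge0.
apply: ge0_le_integral => //.
- by move=> w _; exact: ball_mass_ge0.
- exact: measurable_ball_massl.
- exact: emeasurable_funD.
- move=> w _; rewrite -ball_mass_scale//; apply: ball_massD => //.
    exact: phis_ge0.
  by move=> y _; apply: le_phis => //; rewrite normr0.
Qed.

End invariant_measure.

(** * The normal distribution function and numerical bounds *)

Section normal_cdf.
Context {R : realType}.
Implicit Types t v w x y : R.
Local Notation leb := (@lebesgue_measure R).

Let measurable_tail x :
  measurable_fun [set: R] (fun y => ((y <= x)%R%:R * phi y)%:E).
Proof.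
apply/measurable_EFinP/measurable_funM; last exact: measurable_phis.
by apply: measurable_fun_natb; exact: measurable_fun_ler.
Qed.

Let tail_ge0 x y : (0 <= ((y <= x)%R%:R * phi y)%:E)%E.
Proof. by rewrite lee_fin mulr_ge0 ?phis_ge0. Qed.

Lemma EFin_Phi x : ((Phi x)%:E = \int[leb]_y ((y <= x)%R%:R * phi y)%:E)%E.
Proof.
have -> : Phi x = fine (\int[leb]_y ((y <= x)%R%:R * phi y)%:E)%E.
  congr fine; rewrite [LHS]integral_mkcond; apply: eq_integral => y _.
  by rewrite patchE mem_setE in_itv/=; case: ifP => _; rewrite ?mul1r ?mul0r.
rewrite fineK// ge0_fin_numE; last by apply: integral_ge0.
apply: (@le_lt_trans _ _ 1%E); last exact: ltry.
rewrite -(integral_phis 0 1)//; apply: ge0_le_integral => //.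
- exact: measurable_tail.
- exact: measurable_EFin_phisB.
- by move=> y _; rewrite lee_fin subr0 ler_piMl ?phis_ge0// lern1 leq_b1.
Qed.

Lemma Phi_ge0 x : 0 <= Phi x.
Proof. by rewrite -lee_fin EFin_Phi; apply: integral_ge0. Qed.

Lemma le_Phi x y : x <= y -> Phi x <= Phi y.
Proof.
move=> xy; rewrite -lee_fin !EFin_Phi; apply: ge0_le_integral => //;
  [exact: measurable_tail..|move=> z _].
rewrite lee_fin ler_wpM2r ?phis_ge0// ler_nat.
by case: leP => // zx; rewrite (le_trans zx xy).
Qed.

(** On [x - 1, x], a segment of length 1, the density is at least its value at [|x| + 1]. *)
Lemma Phi_gt0 x : 0 < Phi x.
Proof.
apply: (@lt_le_trans _ _ (phi (`|x| + 1))); first exact: phis_gt0.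
rewrite -lee_fin EFin_Phi.
have -> : (phi (`|x| + 1))%:E =
    (\int[leb]_y ((phi (`|x| + 1))%:E * (\1_`[x - 1, x - 1 + 1] y)%:E))%E.
  rewrite ge0_integralZl ?lee_fin ?phis_ge0//; last exact/measurable_EFinP.
  by rewrite integral_indic// setIT/= lebesgue_measure_segment// mule1.
apply: ge0_le_integral => //.
- by move=> y _; rewrite mule_ge0// lee_fin ?phis_ge0.
- by apply: measurable_funeM; exact/measurable_EFinP.
- exact: measurable_tail.
- move=> y _; rewrite -EFinM lee_fin indicE mem_setE in_itv/= subrK mulrC.
  case: (leP y x) => [yx|_]; last by rewrite andbF mul0r mul0r.
  case: (leP (x - 1) y) => [xy|_]; last by rewrite mul0r mul1r phis_ge0.
  rewrite !mul1r; apply: le_phis => //; rewrite [leRHS]ger0_norm ?addr_ge0//.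
  have := ler_norm x; have := ler_norm (- x); rewrite normrN => ? ?.
  by rewrite ler_norml; apply/andP; split; lra.
Qed.

(** After rescaling to variance 1, the line splits into ]-t, t[ and two tails, which have equal mass
    by symmetry. *)
Lemma ball_mass_Phi v x : 0 < v -> 0 < x ->
  (ball_mass v x 0 + (2 * Phi (- (x / Num.sqrt v)))%:E = 1)%E.
Proof.
move=> v0 x0; have s0 : 0 < Num.sqrt v by rewrite sqrtr_gt0.
have -> : ball_mass v x 0 = ball_mass v (Num.sqrt v * (x / Num.sqrt v)) 0.
  by rewrite [_ * (_ / _)]mulrC divfK// gt_eqF.
rewrite ball_mass_scale//.
rewrite sqr_sqrtr ?(ltW v0)// divff ?gt_eqF//.
have : 0 < x / Num.sqrt v by rewrite divr_gt0.
move: (_ / _) => t t0; rewrite mulr2n mulrDl mul1r EFinD.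
have upper : (Phi (- t))%:E = (\int[leb]_y ((t <= y)%R%:R * phi y)%:E)%E.
  rewrite EFin_Phi [RHS](ge0_integral_affine R 0 (-1)).
  - rewrite normrN1 mul1e; apply: eq_integral => y _.
    by rewrite add0r mulN1r -[phi (- y)]phisN opprK lerNr.
  - by rewrite oppr_eq0 oner_eq0.
  - apply/measurable_EFinP/measurable_funM; last exact: measurable_phis.
    by apply: measurable_fun_natb; exact: measurable_fun_ler.
  - by move=> y; rewrite lee_fin mulr_ge0 ?phis_ge0.
have mupper : measurable_fun [set: R] (fun y => ((t <= y)%R%:R * phi y)%:E).
  apply/measurable_EFinP/measurable_funM; last exact: measurable_phis.
  by apply: measurable_fun_natb; exact: measurable_fun_ler.
have upper0 y : (0 <= ((t <= y)%R%:R * phi y)%:E)%E.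
  by rewrite lee_fin mulr_ge0 ?phis_ge0.
rewrite {2}upper EFin_Phi -ge0_integralD//; last exact: measurable_tail.
rewrite /ball_mass -ge0_integralD//; last 4 first.
- by move=> y _; exact: ball_mass_integrand_ge0.
- exact: measurable_ball_mass_integrand.
- by move=> y _; rewrite adde_ge0.
- by apply: emeasurable_funD => //; exact: measurable_tail.
rewrite -(integral_phis 0 1)//; apply: eq_integral => y _.
rewrite -!EFinD subr0 -!mulrDl -[in RHS](mul1r (phis 1 y)).
congr (_ * _)%:E; case: (ger0P y) => y0.
  rewrite [y <= - t]leNgt (_ : (- t < y)) ?add0r; last lra.
  by case: (ltP y t) => _; rewrite ?addr0 ?add0r.
rewrite [t <= y]leNgt (_ : (y < t)) ?addr0; last lra.
by rewrite ltrNl; case: (ltP (- t) y) => _; rewrite ?addr0 ?add0r.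
Qed.

(** The triple-angle formula at [pi / 6] reads (s + 1) (2 s - 1)^2 = 0 for s = sin(pi / 6) > 0, so s
    = 1/2. The mean value theorem and cos <= 1 then give 1/2 <= pi / 6. *)
Lemma pi_ge3 : 3 <= pi :> R.
Proof.
have pi0 := @pi_gt0 R.
have s2 : sin (pi / 6) = 1 / 2 :> R.
  have p6 : 0 < sin (pi / 6 : R) by apply: sin_gt0_pi; lra.
  have := @sin_pihalf R.
  have -> : pi / 2 = pi / 6 + (pi / 6 + pi / 6) :> R by field.
  rewrite sinD [sin (_ + _)]sinD cosD.
  have := cos2Dsin2 (pi / 6 : R).
  set s := sin _ in p6 *; set c := cos _ => cs s3.
  have c2 : c ^+ 2 = 1 - s ^+ 2 by rewrite -cs addrK.
  have : (s + 1) * (2 * s - 1) ^+ 2 = 0.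
    transitivity (1 - (3 * s * c ^+ 2 - s ^+ 3)); first by rewrite c2; ring.
    by rewrite -[X in X - _]s3; ring.
  by move/eqP; rewrite mulf_eq0 sqrf_eq0 => /orP[] /eqP ?; lra.
have p6 : 0 < pi / 6 :> R by lra.
have csin : {within `[0, (pi / 6 : R)], continuous sin}.
  by apply: continuous_subspaceT => x; exact: continuous_sin.
have [x _] := MVT p6 (fun x _ => is_derive_sin x) csin.
rewrite s2 sin0 !subr0 => e.
have : cos x * (pi / 6) <= pi / 6 by rewrite ler_piMl ?cos_le1//; lra.
by rewrite -e; lra.
Qed.

(* Bounds the density on the four quarters of [0, 1] by its left endpoint value,
   using exp(-t) <= 1 / (1 + t). *)
Lemma ball_mass1_le : (ball_mass 1 1 0 <= (3 / 4 : R)%:E)%E.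
Proof.
have step (x b : R) : 0 <= x -> 0 <= b -> 1 <= b * (1 + x ^+ 2 / 2) ->
    (ball_mass 1 (x + 4^-1) 0 <= ball_mass 1 x 0 + (b / 2 * phis 1 0)%:E)%E.
  move=> x0 b0 bx.
  have -> : b / 2 * phis 1 0 = 2 * 4^-1 * (b * phis 1 0) by field.
  apply: ball_massD => //; first by rewrite mulr_ge0 ?phis_ge0.
  move=> y xy; apply: (@le_trans _ _ (phis 1 x)).
    by apply: le_phis => //; rewrite ger0_norm.
  rewrite /phis expr0n/= oppr0 mul0r expR0 !mulr1 mulrC ler_wpM2r ?invr_ge0//.
  rewrite mulNr expRN -[leRHS]invrK lef_pV2 ?posrE ?invr_gt0 ?expR_gt0//; last first.
    by rewrite lt0r b0 andbT; apply/eqP => b00; move: bx; rewrite b00 mul0r ler10.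
  have b1 : 0 < b.
    by rewrite lt0r b0 andbT; apply/eqP => b00; move: bx; rewrite b00 mul0r ler10.
  rewrite (le_trans _ (expR_ge1Dx _))//.
  by rewrite -[leLHS]mul1r ler_pdivrMr// mulrC.
(* By [pi_ge3], 2 pi >= 6 >= (22/9)^2. The four quarters have the factors 1, 32/33, 8/9 and 32/41,
   the values of 1 / (1 + x^2 / 2) at their left ends. Their sum is below 11/3, and half of 11/3
   times 9/22 is exactly 3/4. *)
have p0 : phis 1 0 <= 9 / 22 :> R.
  rewrite /phis expr0n/= oppr0 mul0r expR0 !mulr1.
  have p2 : 0 < 2 * pi :> R by rewrite mulr_gt0 ?pi_gt0.
  rewrite -[leRHS]invrK lef_pV2 ?posrE ?invr_gt0 ?sqrtr_gt0//.
  rewrite -(@ler_pXn2r _ 2)// ?nnegrE//.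
  by rewrite sqr_sqrtr ?(ltW p2)//; have := @pi_ge3; lra.
have /= s1 := step 0 1 (lexx 0) ler01.
have /= s2 := step (1 / 4) (32 / 33) _ _ _.
have /= s3 := step (1 / 2) (8 / 9) _ _ _.
have /= s4 := step (3 / 4) (32 / 41) _ _ _.
have e1 : 1 = 3 / 4 + 4^-1 :> R by field.
have e2 : 3 / 4 = 1 / 2 + 4^-1 :> R by field.
have e3 : 1 / 2 = 1 / 4 + 4^-1 :> R by field.
have e4 : 1 / 4 = 0 + 4^-1 :> R by field.
rewrite [in X in ball_mass _ X]e1.
apply: (le_trans (s4 _ _ _)); [lra..|].
rewrite {1}e2; apply: (le_trans (leeD2r _ (s3 _ _ _))); [lra..|].
rewrite {1}e3; apply: (le_trans (leeD2r _ (leeD2r _ (s2 _ _ _)))); [lra..|].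
rewrite {1}e4; apply: (le_trans (leeD2r _ (leeD2r _ (leeD2r _ (s1 _))))); [lra..|].
rewrite ball_mass_le0// add0e -!EFinD lee_fin.
lra.
Qed.

(** The two tails beyond 1 share at least 1 - 3/4. This is the point [t = 1] of the supremum in
    [zeta]. *)
Lemma Phi_N1_ge : 8^-1 <= Phi (- 1 : R).
Proof.
have := ball_mass_Phi 1 1 ltr01 ltr01; rewrite sqrtr1 divr1 => e.
have : (1%:E <= (3 / 4 + 2 * Phi (- 1))%:E :> \bar R)%E.
  by rewrite -{1}e EFinD leeD2r// ball_mass1_le.
by rewrite lee_fin; lra.
Qed.

(* Needed because [sup] of an unbounded set is 0. *)
Lemma sqr_mul_Phi_ubound :
  has_ubound [set t ^+ 2 * Phi (- t) | t in [set t : R | 0 <= t]].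
Proof.
(* On [y <= - t] one has t^2 <= y^2. The factor exp(-y^2 / 2) of [phi y] is split into two equal
   halves: one absorbs y^2, since y^2 exp(-y^2 / 4) <= 4, and the other is [phis 2 y / phis 2 0],
   which is integrable. *)
pose c := 4 * phis 1 0 / phis 2 0 : R.
exists c => _ [t /= t0 <-].
rewrite -lee_fin EFinM EFin_Phi -ge0_integralZl//; last 2 first.
- exact: measurable_tail.
- by rewrite lee_fin sqr_ge0.
have c0 : 0 <= c by rewrite divr_ge0 ?phis_ge0// mulr_ge0 ?phis_ge0.
rewrite -[c%:E]mule1 -(integral_phis 0 2)// -ge0_integralZl//; last 2 first.
- exact: measurable_EFin_phisB.
- by move=> y _; rewrite lee_fin phis_ge0.
apply: ge0_le_integral => //.
- by move=> y _; rewrite mule_ge0// lee_fin sqr_ge0.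
- by apply: measurable_funeM; exact: measurable_tail.
- by apply: measurable_funeM; exact: measurable_EFin_phisB.
move=> y _; rewrite -!EFinM lee_fin subr0.
have [yt|_] := leP y (- t); last first.
  by rewrite mul0r mulr0 mulr_ge0 ?phis_ge0.
rewrite mul1r (@le_trans _ _ (y ^+ 2 * phi y))//.
  rewrite ler_wpM2r ?phis_ge0// -[leRHS]sqrrN ler_pXn2r ?nnegrE//; lra.
have -> : phi y = phis 1 0 * expR (- (y ^+ 2 / 4)) * expR (- (y ^+ 2 / 4)).
  rewrite /phi /phis expr0n/= oppr0 mul0r expR0 !mulr1 -mulrA -expRD.
  by congr (_ * expR _); field.
have -> : phis 2 y = phis 2 0 * expR (- (y ^+ 2 / 4)).
  rewrite /phis expr0n/= oppr0 mul0r expR0 !mulr1.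
  by congr (_ * expR _); field.
have yE : y ^+ 2 * expR (- (y ^+ 2 / 4)) <= 4.
  rewrite expRN ler_pdivrMr ?expR_gt0//.
  by have := expR_ge1Dx (y ^+ 2 / 4); lra.
have E0 := expR_ge0 (- (y ^+ 2 / 4)); have p0 := phis_ge0 1 (0 : R).
rewrite [c * (_ * _)]mulrA (_ : c * phis 2 0 = 4 * phis 1 0); last first.
  by rewrite divfK// gt_eqF// phis_gt0.
have -> : y ^+ 2 * (phis 1 0 * expR (- (y ^+ 2 / 4)) * expR (- (y ^+ 2 / 4))) =
  y ^+ 2 * expR (- (y ^+ 2 / 4)) * (phis 1 0 * expR (- (y ^+ 2 / 4))) by ring.
by rewrite -[leRHS]mulrA ler_wpM2r// mulr_ge0.
Qed.

End normal_cdf.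

(** * Growth of the variance and summation of the errors *)

Section variance_sequence.
Context {R : realType} (u k : R).
Hypotheses (u0 : 0 < u) (k1 : 1 <= k).

(* The variance after n steps, rescaled by the expansion factor k at each step. *)
Fixpoint var_seq (n : nat) : R :=
  if n is n'.+1 then (var_seq n' + u) / k ^+ 2 else 0.

(** Unrolled, the variance is the sum of u / k^(2 j) for j from 1 to n, and each term is at least
    the last one. *)
Lemma var_seq_ge n : u * n%:R / k ^+ n ^+ 2 <= var_seq n.
Proof.
have k0 : 0 < k by exact: lt_le_trans k1.
elim: n => [|n ih] /=; first by rewrite mulr0 mul0r.
rewrite [k ^+ n.+1]exprS exprMn invfM mulrA mulrAC ler_wpM2r ?invr_ge0 ?sqr_ge0//.
rewrite -natr1 mulrDr mulr1 mulrDl lerD// ler_pdivrMr ?exprn_gt0//.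
by rewrite ler_peMr ?(ltW u0)// !exprn_ege1.
Qed.

Lemma var_seq_gt0 n : 0 < var_seq n.+1.
Proof.
have k0 : 0 < k by exact: lt_le_trans k1.
apply: lt_le_trans (var_seq_ge n.+1).
by rewrite divr_gt0 ?exprn_gt0// mulr_gt0.
Qed.

(** The peak of a Gaussian density decreases in the variance, and [var_seq n + u] is [k ^+ 2] times
    the next variance, so it inherits the bound of [var_seq_ge] with one factor [k ^+ 2] removed. *)
Lemma phis_var_seq_le n :
  phis (var_seq n + u) 0 <= k ^+ n / (Num.sqrt (2 * pi * u) * Num.sqrt n.+1%:R).
Proof.
have k0 : 0 < k by exact: lt_le_trans k1.
have kn : 0 < k ^+ n by rewrite exprn_gt0.
have p0 : 0 < 2 * pi :> R by rewrite mulr_gt0 ?pi_gt0.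
have le_v : u * n.+1%:R / k ^+ n ^+ 2 <= var_seq n + u.
  have := var_seq_ge n.+1; rewrite /= [k ^+ n.+1]exprS exprMn invfM mulrA mulrAC.
  by rewrite ler_pM2r// invr_gt0 exprn_gt0.
rewrite /phis expr0n/= oppr0 mul0r expR0 mulr1.
have v0 : 0 < var_seq n + u.
  by apply: lt_le_trans le_v; rewrite divr_gt0 ?exprn_gt0// mulr_gt0.
have s0 : 0 < Num.sqrt (2 * pi * (var_seq n + u)) by rewrite sqrtr_gt0 mulr_gt0.
have s1 : 0 < Num.sqrt (2 * pi * u) * Num.sqrt n.+1%:R.
  by rewrite mulr_gt0 ?sqrtr_gt0// mulr_gt0.
rewrite -[k ^+ n]invrK -invfM lef_pV2 ?posrE//; last by rewrite mulr_gt0 ?invr_gt0.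
rewrite -[(k ^+ n)^-1]gtr0_norm ?invr_gt0// -sqrtr_sqr -!sqrtrM ?sqr_ge0//; last first.
  by rewrite mulr_ge0 ?(ltW p0) ?(ltW u0).
rewrite ler_wsqrtr// exprVn mulrC -!mulrA ler_wpM2l// ler_wpM2l ?pi_ge0//.
by rewrite mulrA.
Qed.

End variance_sequence.

(** With a and b the two roots, b^2 - a^2 = 1, and the claim multiplied by b becomes (b - a)^2 >= 0.
    It makes the sum of the first n inverse square roots at most 2 sqrt n. *)
Lemma sqrtr_telescope (R : rcfType) (n : nat) :
  2 * Num.sqrt n%:R + (Num.sqrt n.+1%:R)^-1 <= 2 * Num.sqrt (n.+1%:R : R).
Proof.
set a := Num.sqrt n%:R; set b := Num.sqrt n.+1%:R.
have b0 : 0 < b by rewrite sqrtr_gt0.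
have a2 : a ^+ 2 = n%:R by rewrite sqr_sqrtr.
have b2 : b ^+ 2 = a ^+ 2 + 1 by rewrite a2 sqr_sqrtr// natr1.
rewrite -(ler_pM2r b0) mulrDl mulVf ?gt_eqF//.
have : 0 <= (b - a) ^+ 2 by rewrite sqr_ge0.
by nra.
Qed.

(** * Iteration of the one-step estimates *)

Section sticky_bound.
Context {R : realType} (mu : probability R R).
Variables (Q : R -> set R -> \bar R) (u k h : R).
Hypotheses (u0 : 0 < u) (k1 : 1 <= k) (h0 : 0 <= h).
Hypothesis mu_neg : mu `]-oo, 0[%classic = 0%E.
Hypothesis mu_inv : forall A : set R, measurable A ->
  mu A = (\int[mu]_w Q w A)%E.
Hypothesis Q0 : forall w A, (0 <= Q w A)%E.
Hypothesis Q_tail : forall w r : R, 0 <= w -> 0 <= r ->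
  (Q w `]r, +oo[%classic <= ball_mass u (k * w + h) r)%E.

Lemma invariant_pos_le n :
  (mu `]0%R, +oo[%classic <= \int[mu]_w ball_mass (var_seq u k n.+1) w 0 +
    (2 * h / Num.sqrt (2 * pi * u) * k ^+ n.+1 * (2 * Num.sqrt n.+1%:R))%:E)%E.
Proof.
have k0 : 0 < k by exact: lt_le_trans k1.
have p0 : 0 < 2 * pi :> R by rewrite mulr_gt0 ?pi_gt0.
set c := 2 * h / _; have c0 : 0 <= c by rewrite divr_ge0 ?mulr_ge0.
have drift n' : (\int[mu]_w ball_mass (var_seq u k n' + u) (k * w + h) 0 <=
    \int[mu]_w ball_mass (var_seq u k n'.+1) w 0 +
    (c * k ^+ n'.+1 / Num.sqrt n'.+1%:R)%:E)%E.
  have v0 : 0 < var_seq u k n' + u.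
    by case: n' => [|n']; rewrite ?add0r// addr_gt0// var_seq_gt0.
  apply: (le_trans (ball_mass_drift_le mu k h k0 h0 _ v0)).
  rewrite leeD2l// lee_fin.
  apply: (le_trans (ler_wpM2l _ (phis_var_seq_le u k u0 k1 n'))).
    by rewrite mulr_ge0.
  rewrite (_ : 2 * h * (k ^+ n' / (Num.sqrt (2 * pi * u) * Num.sqrt n'.+1%:R)) =
    c * k ^+ n' / Num.sqrt n'.+1%:R); last first.
    by rewrite /c invfM !mulrA; congr (_ / _); rewrite -!mulrA [k ^+ n' / _]mulrC.
  by rewrite ler_wpM2r ?invr_ge0// ler_wpM2l// exprS ler_peMl// exprn_ge0// ltW.
elim: n => [|n ih].
  (* The indicator of ]0, oo[ is not [ball_mass] at variance 0, since [phis 0] vanishes by the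
     convention 0^-1 = 0. The first step therefore uses the ray itself, and [u] is read as
     [var_seq u k 0 + u]. *)
  apply: (le_trans (invariant_tail_le mu Q u k h mu_neg mu_inv Q0 Q_tail 0 (lexx 0))).
  rewrite -[u in ball_mass u]add0r; apply: (le_trans (drift 0%N)).
  rewrite leeD2l// lee_fin sqrtr1 invr1 !mulr1.
  by rewrite ler_peMr ?mulr_ge0 ?(ltW k0)// ler1n.
apply: (le_trans ih).
have vn := var_seq_gt0 u k u0 k1 n.
apply: (le_trans (leeD2r _
  (invariant_ball_mass_le mu Q u k h u0 mu_neg mu_inv Q0 Q_tail _ vn))).
apply: (le_trans (leeD2r _ (drift n.+1))).
rewrite -addeA leeD2l// -EFinD lee_fin.
have kn := exprn_gt0 n.+1 k0; have := sqrtr_telescope R n.+1.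
set a := Num.sqrt _; set b := Num.sqrt _ => ab.
have a0 : 0 <= a by exact: sqrtr_ge0.
rewrite [k ^+ n.+2]exprS.
have -> : c * (k * k ^+ n.+1) / b + c * k ^+ n.+1 * (2 * a) =
  c * k ^+ n.+1 * (2 * a + k * b^-1) by ring.
have -> : c * (k * k ^+ n.+1) * (2 * b) = c * k ^+ n.+1 * (k * (2 * b)) by ring.
rewrite ler_wpM2l ?mulr_ge0 ?(ltW kn)//.
(* The new error carries one more factor [k]; since [k >= 1], the accumulated error can be given
   that factor too before telescoping. *)
have : k * (2 * a + b^-1) <= k * (2 * b) by rewrite ler_pM2l.
have : 0 <= (k - 1) * (2 * a) by rewrite mulr_ge0 ?mulr_ge0// subr_ge0.
lra.
Qed.

(** In [invariant_pos_le] the indicator of ]0, oo[ exceeds [ball_mass] by twice a normal tail at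
    each positive point. This excess decreases with the point, so on ]0, r[ it is at least its value
    at [r]. *)
Lemma invariant_interval_le n (r : R) :
  (mu `]0%R, r[%classic * (2 * Phi (- (r / Num.sqrt (var_seq u k n.+1))))%:E <=
    (2 * h / Num.sqrt (2 * pi * u) * k ^+ n.+1 * (2 * Num.sqrt n.+1%:R))%:E)%E.
Proof.
have k0 : 0 < k by exact: lt_le_trans k1.
have v0 := var_seq_gt0 u k u0 k1 n.
have := invariant_pos_le n; set c := (X in (X)%:E); set v := var_seq u k n.+1 in v0 *.
set P := 2 * Phi _.
have P0 : 0 <= P by rewrite mulr_ge0 ?Phi_ge0.
have mb : measurable_fun [set: R] (fun w => ball_mass v w 0).
  have := measurable_ball_massl v 1 0 0.
  by apply: eq_measurable_fun => w _; rewrite mul1r addr0.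
have fin : (\int[mu]_w ball_mass v w 0)%E \is a fin_num.
  rewrite ge0_fin_numE; last by apply: integral_ge0 => w _; exact: ball_mass_ge0.
  apply: (@le_lt_trans _ _ 1%E); last exact: ltry.
  rewrite -(@probability_setT _ _ _ mu) -[leRHS]mul1e -integral_cst//.
  apply: ge0_le_integral => //.
  - by move=> w _; exact: ball_mass_ge0.
  - by move=> w _; exact: ball_mass_le1.
move=> le_c; rewrite -(leeD2lE _ _ fin); apply: le_trans le_c.
rewrite muleC -[X in (_ * mu X)%E]setIT -[X in (_ <= mu X)%E]setIT.
rewrite -!integral_indic// -ge0_integralZl//; last first.
- exact/measurable_EFinP.
rewrite -ge0_integralD//; last 3 first.
- by move=> w _; exact: ball_mass_ge0.
- by move=> w _; rewrite mule_ge0// lee_fin.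
- by apply: measurable_funeM; exact/measurable_EFinP.
apply: ge0_le_integral => //.
- by move=> w _; rewrite adde_ge0 ?ball_mass_ge0// mule_ge0// lee_fin.
- by apply: emeasurable_funD => //; apply: measurable_funeM; exact/measurable_EFinP.
- exact/measurable_EFinP.
move=> w _; rewrite !indicE !mem_setE !in_itv/= andbT.
have [w0|w0] := leP w 0.
  by rewrite ball_mass_le0// mule0 adde0.
have [wr|_] := ltP w r; last by rewrite mule0 adde0 ball_mass_le1.
rewrite mule1 -(ball_mass_Phi v w v0 w0) leeD2l// lee_fin ler_wpM2l// le_Phi//.
by rewrite lerN2 ler_wpM2r ?invr_ge0// ltW.
Qed.

End sticky_bound.

(** * The constant [zeta] and the final estimate *)

Lemma sup_sqr_mul_Phi_ge (R : realType) :
  8^-1 <= sup [set t ^+ 2 * Phi (- t) | t in [set t : R | 0 <= t]].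
Proof.
apply: le_trans (Phi_N1_ge) _; apply: ub_le_sup; first exact: sqr_mul_Phi_ubound.
by exists 1 => //=; rewrite expr1n mul1r.
Qed.

(** The supremum and the added 1/8 are each at least 1/8, and the squared factor is at least 1. *)
Lemma zeta_ge (R : realType) (sigma gbar L : R) : 0 < sigma -> 0 <= gbar * L ->
  sigma ^+ 2 / (4 * Num.sqrt (2 * pi)) <= zeta sigma gbar L.
Proof.
move=> sigma0 gL; rewrite /zeta.
have sup_ge := sup_sqr_mul_Phi_ge R; move: (sup _) sup_ge => M M8.
have p0 : 0 < Num.sqrt (2 * pi) :> R by rewrite sqrtr_gt0 mulr_gt0 ?pi_gt0.
have -> : 2 * (1 + gbar * L) ^+ 2 * sigma ^+ 2 * (2 * Num.sqrt (2 * pi))^-1 *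
    (M + 8^-1) =
    (1 + gbar * L) ^+ 2 * (4 * (M + 8^-1)) * (sigma ^+ 2 / (4 * Num.sqrt (2 * pi))).
  by field; rewrite gt_eqF.
rewrite ler_peMl ?divr_ge0 ?sqr_ge0 ?mulr_ge0//.
rewrite -[leLHS]mulr1; apply: ler_pM => //; last lra.
by rewrite exprn_ege1// lerDl.
Qed.

Theorem theorem27 (R : realType) (sigma gbar cinf : R) (tau : R -> R -> R)
  (R1 L m : R)
  (hsigma : 0 < sigma) (hgbar : 0 < gbar) (hcinf : 0 <= cinf)
  (hR1 : 0 <= R1) (hL : 0 <= L) (hm : 0 < m)
  (htau_pos : forall g : R, 0 < g <= gbar -> forall r : R, 0 <= r -> 0 <= tau g r)
  (htau_mono : forall g : R, 0 < g <= gbar ->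
     forall r s : R, 0 <= r -> r <= s -> tau g r <= tau g s)
  (htau0 : forall g : R, 0 < g <= gbar -> tau g 0 = 0)
  (htauL : forall g : R, 0 < g <= gbar ->
     forall r : R, 0 < r -> tau g r / r <= 1 + g * L)
  (htaum : forall g : R, 0 < g <= gbar ->
     forall r : R, R1 < r -> tau g r / r <= 1 - g * m)
  (gamma : R) (hgamma : 0 < gamma <= gbar)
  (mu : probability R R)
  (hmu_supp : mu [set` `]-oo, 0[] = 0%E)
  (hmu_inv : forall A : set R, measurable A ->
     mu A = (\int[mu]_(w in setT) Qker sigma cinf gamma (tau gamma) w A)%E)
  (Rr : R) (hRr : 0 <= Rr)
  (dbar : R) (hdbar : 0 < dbar)
  (hdbarL : 0 < L -> dbar <= L^-1)
  (hdbarc : 0 < cinf -> dbar <= (sigma * (expR 1)^-1 / cinf) ^+ 2) :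
  (mu [set` `]0%R, Rr%R[] <= (etaR sigma gbar L cinf dbar Rr * cinf)%:E)%E.
Proof.
have [gamma0 gammale] := andP hgamma.
have gL : 0 <= gamma * L by rewrite mulr_ge0// ltW.
have gbL : 0 <= gbar * L by rewrite mulr_ge0// ltW.
have k1 : 1 <= 1 + gamma * L by rewrite lerDl.
have h0 : 0 <= gamma * cinf by rewrite mulr_ge0// ltW.
have u0 : 0 < 4 * sigma ^+ 2 * gamma by rewrite !mulr_gt0 ?exprn_gt0.
have Q_tail (w r : R) : 0 <= w -> 0 <= r ->
    (Qker sigma cinf gamma (tau gamma) w `]r, +oo[%classic <=
     ball_mass (4 * sigma ^+ 2 * gamma) ((1 + gamma * L) * w + gamma * cinf) r)%E.
  move=> w0 r0.
  apply: (le_trans (Qker_tail_le _ _ _ _ _ _ hsigma gamma0 r0 _)).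
    by rewrite addr_ge0// htau_pos.
  apply: le_ball_mass; rewrite lerD2r.
  have [->|wn0] := eqVneq w 0; first by rewrite htau0// mulr0.
  by rewrite -ler_pdivrMr ?htauL// lt0r wn0.
(* The chain is run for [n.+1] steps: their total time exceeds [dbar], which bounds the variance
   from below, and is at most [dbar + gbar], which bounds the error from above. *)
pose n := Num.truncn (dbar / gamma).
have /andP[n_le n_gt] : n%:R * gamma <= dbar < n.+1%:R * gamma.
  have /andP[] := truncn_itv (ltW (divr_gt0 hdbar gamma0)).
  by rewrite -/n ler_pdivlMr// ltr_pdivrMr// => -> ->.
have := invariant_interval_le mu (Qker sigma cinf gamma (tau gamma)) _ _ _
  u0 k1 h0 hmu_supp hmu_inv (Qker_ge0 sigma cinf gamma (tau gamma)) Q_tail n Rr.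
set k := 1 + gamma * L in k1 *; set u := 4 * _ * _ in u0 *.
set v := var_seq _ _ _; rewrite -/v.
have mu_fin : mu [set` `]0%R, Rr%R[] \is a fin_num by exact: fin_num_measure.
rewrite -(fineK mu_fin); set p := fine _; rewrite -EFinM !lee_fin => p_le.
have p0 : 0 <= p by exact: fine_ge0.
pose x := expR ((dbar + gbar) * L).
have x0 : 0 < x by exact: expR_gt0.
have N0 : 0 < n.+1%:R :> R by [].
have N_le : n.+1%:R * gamma <= dbar + gbar.
  by rewrite -natr1 mulrDl mul1r lerD.
have k0 : 0 < k by exact: lt_le_trans k1.
have kx : k ^+ n.+1 <= x.
  apply: (@le_trans _ _ (expR (gamma * L) ^+ n.+1)).
    by rewrite lerXn2r ?nnegrE ?expR_ge0 ?(ltW k0)// expR_ge1Dx.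
  by rewrite -expRM_natl ler_expR mulrA ler_wpM2r// mulrC.
pose S := Num.sqrt (2 * pi) : R; pose D := Num.sqrt (dbar + gbar).
have S0 : 0 < S by rewrite sqrtr_gt0 mulr_gt0 ?pi_gt0.
rewrite /etaR -/S -/D -/x; set F := Phi (- _); set A := _ + _.
have F0 : 0 < F by exact: Phi_gt0.
(* Each of the two terms of [A] supplies half of the left side: the first through [zeta_ge], with
   the exponent 3 lowered to 1, the second exactly. *)
have A_ge : x / (S * sigma) <= A.
  have -> : x / (S * sigma) =
      2 * (sigma ^+ 2 / (4 * S)) * x / sigma ^+ 3 + x / (2 * S * sigma).
    by field; rewrite !gt_eqF.
  rewrite lerD2r ler_wpM2r ?invr_ge0 ?exprn_ge0 ?(ltW hsigma)//.
  apply: ler_pM; rewrite ?(ltW x0)//.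
  - by rewrite mulr_ge0// divr_ge0 ?sqr_ge0// mulr_ge0// ltW.
  - by rewrite ler_wpM2l// zeta_ge.
  - rewrite ler_expR ler_wpM2r// ler_peMl ?addr_ge0 ?(ltW hdbar) ?(ltW hgbar)//.
    by rewrite ler1n.
(* By [var_seq_ge], [v] is at least [4 * sigma ^+ 2 * dbar / x ^+ 2], whose root is the denominator
   in [etaR]; the numerator there is at least [Rr]. *)
have F_le : F <= Phi (- (Rr / Num.sqrt v)).
  have sv0 : 0 < Num.sqrt v by rewrite sqrtr_gt0; exact: var_seq_gt0.
  have sd0 : 0 < Num.sqrt dbar by rewrite sqrtr_gt0.
  have E0 := expR_gt0 (- ((dbar + gbar) * L)).
  apply: le_Phi; rewrite lerN2; apply: ler_pM => //.
  - rewrite -[leLHS]mul1r -[leLHS]addr0 lerD ?ler_wpM2r ?lerDl//.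
    by rewrite mulr_ge0// addr_ge0 ?(ltW hdbar) ?(ltW hgbar).
  - rewrite lef_pV2 ?posrE ?mulr_gt0//.
    rewrite -(@ler_pXn2r _ 2)// ?nnegrE ?(ltW sv0)//; last by rewrite !mulr_ge0 ?ltW.
    rewrite sqr_sqrtr; last by apply: ltW; exact: var_seq_gt0.
    apply: le_trans (var_seq_ge _ _ u0 k1 n.+1).
    rewrite expRN -/x !exprMn sqr_sqrtr ?(ltW hdbar)// exprVn.
    apply: ler_pM; rewrite ?mulr_ge0 ?invr_ge0 ?sqr_ge0 ?(ltW hdbar) ?(ltW hsigma)//.
      have -> : u * n.+1%:R = 2 ^+ 2 * sigma ^+ 2 * (n.+1%:R * gamma) by rewrite /u; ring.
      by rewrite mulrAC ler_wpM2l ?mulr_ge0 ?sqr_ge0// ltW.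
    rewrite lef_pV2 ?posrE ?exprn_gt0//.
    by rewrite ler_pXn2r// nnegrE ltW// exprn_gt0.
rewrite mulrAC ler_pdivlMr//.
apply: (@le_trans _ _ (D * (x / (S * sigma)) * cinf)); last first.
  by rewrite ler_wpM2r// ler_wpM2l// sqrtr_ge0.
have sg0 : 0 < Num.sqrt gamma by rewrite sqrtr_gt0.
(* With [u = (2 * sigma) ^+ 2 * gamma], one factor sqrt gamma of [gamma * cinf] cancels. The other
   joins the root of [n.+1], and the product is at most [D]. *)
have pF : p * F <= Num.sqrt gamma * Num.sqrt n.+1%:R * (k ^+ n.+1 / (S * sigma)) * cinf.
  rewrite -(@ler_pM2l _ 2)// mulrCA.
  apply: (@le_trans _ _ (p * (2 * Phi (- (Rr / Num.sqrt v))))).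
    by rewrite ler_wpM2l// ler_wpM2l.
  apply: (le_trans p_le).
  have -> : Num.sqrt (2 * pi * u) = S * (2 * sigma * Num.sqrt gamma).
    rewrite sqrtrM ?mulr_ge0 ?pi_ge0//; congr (_ * _).
    have -> : u = (2 * sigma) ^+ 2 * gamma by rewrite /u; ring.
    by rewrite sqrtrM ?sqr_ge0// sqrtr_sqr gtr0_norm// mulr_gt0.
  rewrite -{1}(sqr_sqrtr (ltW gamma0)) le_eqVlt; apply/orP; left; apply/eqP.
  by field; rewrite !gt_eqF.
apply: (le_trans pF); rewrite ler_wpM2r//; apply: ler_pM.
- by rewrite mulr_ge0 ?sqrtr_ge0.
- by rewrite divr_ge0 ?exprn_ge0 ?mulr_ge0 ?(ltW k0) ?(ltW S0) ?(ltW hsigma).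
- by rewrite -sqrtrM ?(ltW gamma0)// ler_wsqrtr// mulrC.
- by rewrite ler_wpM2r// invr_ge0 mulr_ge0// ltW.
Qed.
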